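(* Let $\mathcal A$ be a cluster algebra and let $H_1,H_2$ be subgroups of $\mathrm{Aut}\,\mathcal A$ with $H_1,H_2\notin\ker\phi$, i.e. $\mathcal M^{H_1}_{sub}\neq\emptyset$ and $\mathcal M^{H_2}_{sub}\neq\emptyset$. Then $H_1$ and $H_2$ are conjugate in $\mathrm{Aut}\,\mathcal A$ if and only if there exist $f\in\mathrm{Aut}\,\mathcal A$, $\mathcal A(\Sigma_1)\in\mathcal M^{H_1}_{sub}$ and $\mathcal A(\Sigma_2)\in\mathcal M^{H_2}_{sub}$ such that $f(\mathcal A(\Sigma_1))=\mathcal A(\Sigma_2)$ and the restriction of $f$ is a cluster isomorphism $\mathcal A(\Sigma_1)\to\mathcal A(\Sigma_2)$.
   Context: Cluster algebras: a seed is $\Sigma=(\mathbf x_{ex},\mathbf x_{fr},\widetilde B)$ with exchange variables $\mathbf x_{ex}=\{x_1,\dots,x_n\}$ and frozen variables $\mathbf x_{fr}=\{x_{n+1},\dots,x_m\}$ algebraically independent in $\mathcal F=\mathbb Q(x_1,\dots,x_m)$, and $\widetilde B=(b_{ij})$ an $m\times n$ integer matrix whose upper $n\times n$ part is skew-symmetrizable; entries are also indexed by variables, $b_{xy}$. Seeds mutate by the Fomin–Zelevinsky mutation rule at exchange variables; the cluster algebra $\mathcal A(\Sigma)$ is the $\mathbb Q$-subalgebra of $\mathcal F$ generated by all (exchange and frozen) cluster variables of all seeds obtained from $\Sigma$ by finitely many mutations. A cluster automorphism (resp. cluster isomorphism) is an algebra automorphism (resp. isomorphism) sending the extended cluster $\mathbf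 x_{ex}\cup\mathbf x_{fr}$ of a seed bijectively onto the extended cluster of a seed, exchange variables to exchange variables, and commuting with mutations ($f(\mu_x(y))=\mu_{f(x)}(f(y))$ along admissible mutation sequences); $\mathrm{Aut}\,\mathcal A$ is the group of cluster automorphisms. Mixing-type sub-seed: for a seed $\Sigma$ and $I_0\subseteq\mathbf x_{ex}$, $I_1\subseteq\mathbf x_{ex}\cup\mathbf x_{fr}$ with $I_0\cap I_1=\emptyset$, $\Sigma_{I_0,I_1}=(\mathbf x_{ex}\setminus(I_0\cup I_1),(\mathbf x_{fr}\cup I_0)\setminus I_1,\widetilde B^\sharp)$ where $\widetilde B^\sharp$ is the submatrix of $\widetilde B$ with rows indexed by the new extended cluster and columns by the new exchange variables. A cluster subalgebra of $\mathcal A$ is $\mathcal A(\Sigma')\subseteq\mathcal A$ with $\Sigma'=\Sigma_{I_0,I_1}$ for some seed $\Sigma$ of $\mathcal A$ such that $b_{xy}=0$ for all $x\in I_1$, $y\in\mathbf x_{ex}\setminus(I_0\cup I_1)$. Galois notions: for a cluster subalgebra $\mathcal A(\Sigma')$, $\mathrm{Gal}_{\Sigma'}\mathcal A=\{f\in\mathrm{Aut}\,\mathcal A: f|_{\mathcal A(\Sigma')}=\mathrm{id}\}$. For $H\le\mathrm{Aut}\,\mathcal A$, $\mathcal A^H=\{z\in\mathcal A: f(z)=z\ \forall f\in H\}$, and $\mathcal M^H_{sub}$ is the set of cluster subalgebras $\mathcal A(\Sigma')$ of $\mathcal A$ that are maximal (under inclusion) among cluster subalgebras of $\mathcal A$ contained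 in $\mathcal A^H$ and satisfy $\mathrm{Gal}_{\Sigma'}\mathcal A=H$. $\phi$ is the map $H\mapsto\mathcal M^H_{sub}$ and $\ker\phi=\{H\le\mathrm{Aut}\,\mathcal A:\mathcal M^H_{sub}=\emptyset\}$. *)

(* Defs.v *)
From HB Require Import structures.
From mathcomp Require Import all_boot all_order all_algebra.
From mathcomp Require Import finmap.
From mathcomp Require Import mpoly.
Set Implicit Arguments. Unset Strict Implicit. Unset Printing Implicit Defensive.
Import Order.TTheory GRing.Theory Num.Theory.
Local Open Scope fset_scope.
Local Open Scope ring_scope.

Section Cluster.
(* n exchange variables, k frozen variables, m = n + k *)
Variables (n k : nat) (B : 'M[int]_(n + k, n)).

Definition Fld := {fraction {mpoly rat[n + k]}}.

Definition xv (i : 'I_(n + k)) : Fld := tofrac ('X_i : {mpoly rat[n + k]}).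

(* Seeds, with the (extended) exchange matrix indexed by variables:
   sb y x = b_{yx}. *)
Record seed := Seed {
  sex : {fset Fld};          (* exchange variables *)
  sfr : {fset Fld};          (* frozen variables *)
  sb  : Fld -> Fld -> int }. (* b_{xy}, only meaningful on ext x ex *)

Definition ext (S : seed) : {fset Fld} := sex S `|` sfr S.

Definition newvar (S : seed) (x : Fld) : Fld :=
  ((\prod_(y <- ext S | 0 < sb S y x) y ^+ `|sb S y x|%N)
   + (\prod_(y <- ext S | sb S y x < 0) y ^+ `|sb S y x|%N)) / x.

Definition mutb (S : seed) (x i j : Fld) : int :=
  if (i == x) || (j == x) then (- sb S i j)%R
  else (sb S i j + sgz (sb S i x) * Num.max (sb S i x * sb S x j) 0)%R.

Definition mutate (S : seed) (x : Fld) : seed :=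
  if x \in sex S then
    let x' := newvar S x in
    let ex' := x' |` (sex S `\ x) in
    let ext' := ex' `|` sfr S in
    Seed ex' (sfr S)
      (fun u v => if (u \in ext') && (v \in ex') then
                    mutb S x (if u == x' then x else u) (if v == x' then x else v)
                  else 0)
  else S.

Fixpoint adm (S : seed) (xs : seq Fld) : Prop :=
  match xs with
  | [::] => True
  | x :: xs' => x \in sex S /\ adm (mutate S x) xs'
  end.

Definition mutseq (S : seed) (xs : seq Fld) : seed := foldl mutate S xs.

Definition reach (S T : seed) : Prop :=
  exists xs, adm S xs /\ T = mutseq S xs.

Definition clvar (S : seed) (z : Fld) : Prop :=
  exists T, reach S T /\ z \in ext T.

Inductive qgen (P : Fld -> Prop) : Fld -> Prop :=
  | qgen_var z : P z -> qgen P z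
  | qgen_rat (q : rat) : qgen P (ratr q)
  | qgen_add z w : qgen P z -> qgen P w -> qgen P (z + w)
  | qgen_mul z w : qgen P z -> qgen P w -> qgen P (z * w).

Definition Acl (S : seed) : Fld -> Prop := qgen (clvar S).

Definition seed0 : seed :=
  Seed [fset xv (lshift k i) | i : 'I_n]
       [fset xv (rshift n j) | j : 'I_k]
       (fun u v => \sum_(i < n + k) \sum_(j < n)
          (if (u == xv i) && (v == xv (lshift k j)) then B i j else 0)).

Definition A0 : Fld -> Prop := Acl seed0.

Definition compat (f : Fld -> Fld) (S S' : seed) : Prop :=
  [/\ (forall y, y \in ext S -> f y \in ext S'),
      (forall y', y' \in ext S' -> exists2 y, y \in ext S & f y = y'),
      {in ext S &, injective f},
      (forall y, y \in ext S -> (y \in sex S) = (f y \in sex S')) &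
      (forall x, x \in sex S -> f (newvar S x) = newvar S' (f x))].

Definition commmut (f : Fld -> Fld) (S S' : seed) : Prop :=
  forall xs, adm S xs -> compat f (mutseq S xs) (mutseq S' (map f xs)).

Definition alg_iso (S1 S2 : seed) (f : Fld -> Fld) : Prop :=
  [/\ (forall z, Acl S1 z -> Acl S2 (f z)),
      (forall w, Acl S2 w -> exists z, Acl S1 z /\ f z = w),
      (forall z z', Acl S1 z -> Acl S1 z' -> f z = f z' -> z = z'),
      f 1 = 1 &
      [/\ forall z w, Acl S1 z -> Acl S1 w -> f (z + w) = f z + f w,
          forall z w, Acl S1 z -> Acl S1 w -> f (z * w) = f z * f w &
          forall (q : rat) z, Acl S1 z -> f (ratr q * z) = ratr q * f z]].

Definition cluster_iso (S1 S2 : seed) (f : Fld -> Fld) : Prop :=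
  alg_iso S1 S2 f /\
  exists T1 T2, [/\ reach S1 T1, reach S2 T2 & commmut f T1 T2].

(* Cluster automorphisms of A, represented by maps F -> F which are the
   identity outside A (so that each automorphism of A has exactly one
   representative). *)
Definition cluster_aut (f : Fld -> Fld) : Prop :=
  cluster_iso seed0 seed0 f /\ forall z, ~ A0 z -> f z = z.

Definition subgroup_aut (H : (Fld -> Fld) -> Prop) : Prop :=
  [/\ forall f, H f -> cluster_aut f,
      H id,
      (forall f g, H f -> H g -> H (f \o g)) &
      forall f, H f -> exists2 g, H g & forall z, g (f z) = z].

Definition conjugate_aut (H1 H2 : (Fld -> Fld) -> Prop) : Prop :=
  exists2 g, cluster_aut g &
    forall f, H2 f <-> exists2 h, H1 h & forall z, f (g z) = g (h z).

Definition subseed (S : seed) (I0 I1 : {fset Fld}) : seed :=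
  let ex' := sex S `\` (I0 `|` I1) in
  let fr' := (sfr S `|` I0) `\` I1 in
  Seed ex' fr'
    (fun u v => if (u \in ex' `|` fr') && (v \in ex') then sb S u v else 0).

Definition cluster_sub (S' : seed) : Prop :=
  [/\ exists S I0 I1,
        [/\ reach seed0 S, (I0 `<=` sex S /\ I1 `<=` ext S), (I0 `&` I1 = fset0),
            (forall x y, x \in I1 -> y \in sex S `\` (I0 `|` I1) -> sb S x y = 0)
          & S' = subseed S I0 I1] &
      forall z, Acl S' z -> A0 z].

Definition fixH (H : (Fld -> Fld) -> Prop) (z : Fld) : Prop :=
  A0 z /\ forall f, H f -> f z = z.

Definition gal_eq (S' : seed) (H : (Fld -> Fld) -> Prop) : Prop :=
  forall f, (cluster_aut f /\ forall z, Acl S' z -> f z = z) <-> H f.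

Definition inM (H : (Fld -> Fld) -> Prop) (S' : seed) : Prop :=
  [/\ cluster_sub S',
      (forall z, Acl S' z -> fixH H z),
      (forall S'', cluster_sub S'' -> (forall z, Acl S'' z -> fixH H z) ->
          (forall z, Acl S' z -> Acl S'' z) -> forall z, Acl S'' z -> Acl S' z) &
      gal_eq S' H].

End Cluster.

Definition skew_symmetrizable (n k : nat) (B : 'M[int]_(n + k, n)) : Prop :=
  exists d : 'I_n -> int, (forall i, 0 < d i) /\
    forall i j : 'I_n, d i * B (lshift k i) j = - (d j * B (lshift k j) i).

(* Main.v *)
Require Import Defs.
From HB Require Import structures.
From mathcomp Require Import all_boot all_order all_algebra.
From mathcomp Require Import finmap mpoly.
From mathcomp Require Import zify ring lra.
From Stdlib Require Import FunctionalExtensionality ClassicalEpsilon.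
Set Implicit Arguments. Unset Strict Implicit. Unset Printing Implicit Defensive.
Import Order.TTheory GRing.Theory Num.Theory.
Local Open Scope fset_scope.
Local Open Scope ring_scope.

(* A cluster automorphism transports cluster subalgebras: if [commmut g S T],
   then the subseed of [S] cut out by (I0, I1) goes to the subseed of [T] cut
   out by (g I0, g I1).  The theorem then follows as in classical Galois theory,
   since Gal of g A(S1) is g (Gal of A(S1)) g^-1 and g preserves maximality.

   What has to be known about seeds is that mutation is involutive, so that all
   seeds of A are reachable from each other, and that the condition b_xy = 0
   for x in I1 survives g.  Both rest on the algebraic independence of an
   extended cluster, which is used in the following weak form: the variables of
   a seed can be given arbitrary positive rational values by evaluating rational
   functions at a suitable point.  This form is stable under mutation because
   the exchange relation can be solved for either variable. *)

(** * Values of rational functions at rational points *)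

Section Evaluation.
Variables n k : nat.
Local Notation F := (Fld n k).
Implicit Types (a : 'I_(n + k) -> rat) (z w : F) (v : rat).

(** A relation rather than a function, since [z] may be undefined at [a]: some fraction for [z] must
    have a denominator that does not vanish there. *)
Definition evalsto a z v := exists p q : {mpoly rat[n + k]},
  [/\ q.@[a] != 0, z * tofrac q = tofrac p & p.@[a] = v * q.@[a]].

Lemma evalsto_poly a (p : {mpoly rat[n + k]}) : evalsto a (tofrac p) p.@[a].
Proof. by exists p, 1; rewrite meval1 tofrac1 !mulr1 oner_neq0. Qed.

(** Cross-multiplying two fractions for [z] gives an identity of polynomials, which can be evaluated
    at [a]. *)
Lemma evalsto_unique a z v v' : evalsto a z v -> evalsto a z v' -> v = v'.
Proof.
move=> [p [q [q0 zq pv]]] [p' [q' [q0' zq' pv']]].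
have /(congr1 (fun r => r.@[a])) : p * q' = p' * q.
  apply/eqP; rewrite -tofrac_eq !tofracM -zq -zq'; apply/eqP; ring.
rewrite /= !mevalM pv pv' => e; apply: (mulfI (mulf_neq0 q0 q0')).
by rewrite mulrC mulrA e; ring.
Qed.

Lemma evalsto1 a : evalsto a 1 1.
Proof. by have := evalsto_poly a 1; rewrite tofrac1 meval1. Qed.

Lemma evalsto_add a z w v v' :
  evalsto a z v -> evalsto a w v' -> evalsto a (z + w) (v + v').
Proof.
move=> [p [q [q0 zq pv]]] [p' [q' [q0' zq' pv']]].
exists (p * q' + p' * q), (q * q'); split.
- by rewrite mevalM mulf_neq0.
- by rewrite tofracD !tofracM -zq -zq'; ring.
- by rewrite mevalD !mevalM pv pv'; ring.
Qed.

Lemma evalsto_mul a z w v v' :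
  evalsto a z v -> evalsto a w v' -> evalsto a (z * w) (v * v').
Proof.
move=> [p [q [q0 zq pv]]] [p' [q' [q0' zq' pv']]].
exists (p * p'), (q * q'); split.
- by rewrite mevalM mulf_neq0.
- by rewrite !tofracM -zq -zq'; ring.
- by rewrite !mevalM pv pv'; ring.
Qed.

Lemma evalsto_neq0 a z v : v != 0 -> evalsto a z v -> z != 0.
Proof.
move=> v0 ev; apply: contraNneq v0 => z0; apply/eqP; apply: evalsto_unique ev _.
by have := evalsto_poly a 0; rewrite tofrac0 meval0 z0.
Qed.

Lemma evalsto_inv a z v : v != 0 -> evalsto a z v -> evalsto a z^-1 v^-1.
Proof.
move=> v0 ev; have z0 := evalsto_neq0 v0 ev; case: ev => p [q [q0 zq pv]].
exists q, p; split.
- by rewrite pv mulf_neq0.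
- by rewrite -zq mulKf.
- by rewrite pv mulKf.
Qed.

Lemma evalsto_exp a z v e : evalsto a z v -> evalsto a (z ^+ e) (v ^+ e).
Proof.
move=> ev; elim: e => [|e IH]; first exact: evalsto1.
by rewrite !exprS; apply: evalsto_mul.
Qed.

Lemma evalsto_prod a (s : seq F) (P : pred F) (h : F -> F) (c : F -> rat) :
  {in s, forall y, evalsto a (h y) (c y)} ->
  evalsto a (\prod_(y <- s | P y) h y) (\prod_(y <- s | P y) c y).
Proof.
move=> hs; rewrite !(big_seq_cond P).
apply: (big_ind2 (evalsto a)); [exact: evalsto1 | |by move=> y /andP[/hs]].
by move=> *; apply: evalsto_mul.
Qed.

End Evaluation.

(** * Exchange polynomials, and invariants of seeds under mutation *)

Section Exchange.
Variables n k : nat.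
Local Notation F := (Fld n k).
Implicit Types (S T : seed n k) (x y z u v : F) (I : {fset F}).

(** The exchange polynomial with [c] substituted for the variables; [R] is general because [c] takes
    values both in the field and in [rat]. *)
Definition exch (R : comNzRingType) S x (c : F -> R) : R :=
  \prod_(y <- ext S | 0 < sb S y x) c y ^+ `|sb S y x|%N +
  \prod_(y <- ext S | sb S y x < 0) c y ^+ `|sb S y x|%N.

Lemma newvarE S x : newvar S x = exch S x id / x.
Proof. by []. Qed.

Lemma eq_exch (R : comNzRingType) S x (c c' : F -> R) :
  {in ext S, forall y, sb S y x != 0 -> c y = c' y} -> exch S x c = exch S x c'.
Proof.
move=> cc; rewrite /exch; congr (_ + _); rewrite big_seq_cond [RHS]big_seq_cond;
  by apply: eq_bigr => y /andP[ys b]; rewrite cc // neq_lt b ?orbT.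
Qed.

Lemma eq_prod_fset (R : comNzRingType) (A B : {fset F}) (P Q : pred F) (f g : F -> R) :
  (forall z, (z \in A) && P z = (z \in B) && Q z) ->
  {in A, forall z, P z -> f z = g z} ->
  \prod_(z <- A | P z) f z = \prod_(z <- B | Q z) g z.
Proof.
move=> AB fg; rewrite -big_filter -[RHS]big_filter.
have AB' : perm_eq [seq z <- A | P z] [seq z <- B | Q z].
  by apply: uniq_perm; rewrite ?filter_uniq ?fset_uniq // => z; rewrite !mem_filter andbC AB andbC.
rewrite -(perm_big _ AB') /=.
by apply: eq_big_seq => z; rewrite mem_filter => /andP[Pz /fg]; apply.
Qed.

Lemma exch_gt0 S x (c : F -> rat) : (forall z, 0 < c z) -> 0 < exch S x c.
Proof. by move=> c0; apply: addr_gt0; apply: prodr_gt0 => y _; apply: exprn_gt0. Qed.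

Lemma exch1 S x : exch S x (fun=> 1 : rat) = 2.
Proof. by rewrite /exch !big1 // => y _; rewrite expr1n. Qed.

Lemma evalsto_exch a S x (h : F -> F) (c : F -> rat) :
  {in ext S, forall y, evalsto a (h y) (c y)} ->
  evalsto a (exch S x h) (exch S x c).
Proof.
by move=> hc; apply: evalsto_add; apply: evalsto_prod => y /hc ?; apply: evalsto_exp.
Qed.

(** Invariants of mutation. [wf_supp] fixes the entries outside the matrix, so that seeds with the
    same clusters and matrix coincide as records; [wf_free] is the weak form of algebraic
    independence. *)
Record wf S : Prop := Wf {
  wf_disj : forall x, x \in sex S -> x \notin sfr S;
  wf_supp : forall u v, ~~ ((u \in ext S) && (v \in sex S)) -> sb S u v = 0;
  wf_skew : exists2 d : F -> int, (forall u, 0 < d u) &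
    {in sex S &, forall u v, d u * sb S u v = - (d v * sb S v u)};
  wf_free : forall c : F -> rat, (forall z, 0 < c z) ->
    exists a, {in ext S, forall y, evalsto a y (c y)} }.

Let fsE := (in_fset1U, in_fsetD1, in_fsetU).

Lemma sex_ext S x : x \in sex S -> x \in ext S.
Proof. by rewrite /ext fsE => ->. Qed.

Section Wf.
Variables (S : seed n k) (wfS : wf S).

Lemma sb_diag x : sb S x x = 0.
Proof.
have [xS|xS] := boolP (x \in sex S); last by rewrite wf_supp // negb_and xS orbT.
have [d d0 /(_ x x xS xS)] := wf_skew wfS; have := d0 x; nia.
Qed.

Lemma ext_neq0 x : x \in ext S -> x != 0.
Proof.
move=> xS; have [//|a /(_ x xS)] := @wf_free _ wfS (fun=> 1).
exact: evalsto_neq0 (oner_neq0 _).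
Qed.

Lemma exch_neq0 x : exch S x id != 0.
Proof.
have [//|a /evalsto_exch] := @wf_free _ wfS (fun=> 1).
by move=> /(_ x) /evalsto_neq0; apply; rewrite exch1.
Qed.

(** Where all variables of [S] take the value 1, both exchange monomials are 1, so the new variable
    takes the value 2. *)
Lemma newvar_fresh x : x \in sex S -> newvar S x \notin ext S.
Proof.
move=> xS; apply/negP => xS'; have [//|a ha] := @wf_free _ wfS (fun=> 1).
have := ha _ xS'; rewrite newvarE => /evalsto_unique.
move=> /(_ (2 / 1)) e; suff /e : evalsto a (exch S x id / x) (2 / 1) by [].
apply: evalsto_mul; last by apply: evalsto_inv => //; apply/ha/sex_ext.
by rewrite -(exch1 S x); apply: evalsto_exch.
Qed.

End Wf.

Lemma ext_mutate S x : wf S -> x \in sex S ->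
  ext (mutate S x) = newvar S x |` (ext S `\ x).
Proof.
move=> wfS xS; rewrite /mutate xS /ext.
move: (newvar S x) => x'; apply/fsetP => z.
have := @wf_disj _ wfS z; rewrite /= !fsE.
case: (z == x'); case: eqP => [->|_]; rewrite ?xS //.
by move=> /(_ isT)/negPf->.
Qed.

Lemma mem_ext_mutate S x z : wf S -> x \in sex S ->
  (z \in ext (mutate S x)) = (z == newvar S x) || (z != x) && (z \in ext S).
Proof. by move=> wfS xS; rewrite ext_mutate // in_fset1U in_fsetD1. Qed.

(** Here [p], [q], [r], [s] stand for the entries at (i,x), (x,j), (j,x), (x,i). The products
    [p * q] and [r * s] agree up to positive weights, and when they are positive [p] and [r] have
    opposite signs. *)
Lemma mutation_term_skew (di dj dx p q r s : int) :
  0 < di -> 0 < dj -> 0 < dx -> di * p = - (dx * s) -> dj * r = - (dx * q) ->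
  di * (sgz p * Num.max (p * q) 0) = - (dj * (sgz r * Num.max (r * s) 0)).
Proof.
move=> di0 dj0 dx0 ep er.
have e : dj * (r * s) = di * (p * q).
  apply: (mulfI (lt0r_neq0 dx0)).
  have -> : dx * (dj * (r * s)) = dx * s * (dj * r) by ring.
  have -> : dx * (di * (p * q)) = dx * q * (di * p) by ring.
  by rewrite er ep; ring.
have em : dj * Num.max (r * s) 0 = di * Num.max (p * q) 0.
  by rewrite !maxr_pMr ?ltW // e !mulr0.
rewrite mulrCA [dj * _]mulrCA em -mulNr.
have [pq|pq] := lerP (p * q) 0; first by rewrite !mulr0.
congr (_ * _); have [p0|p0|p0] := ltgtP p 0.
- have r0 : 0 < r by nia.
  by rewrite (ltr0_sgz p0) (gtr0_sgz r0).
- have r0 : r < 0 by nia.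
  by rewrite (gtr0_sgz p0) (ltr0_sgz r0).
- by move: pq; rewrite p0 mul0r ltxx.
Qed.

Lemma mutb_skew (d : F -> int) S x i j : (forall u, 0 < d u) ->
  {in sex S &, forall u v, d u * sb S u v = - (d v * sb S v u)} ->
  x \in sex S -> i \in sex S -> j \in sex S ->
  d i * mutb S x i j = - (d j * mutb S x j i).
Proof.
move=> d0 sk xS iS jS; rewrite /mutb; have e := sk i j iS jS.
case: (i == x); case: (j == x) => /=; rewrite ?mulrN ?e //.
have := mutation_term_skew (d0 i) (d0 j) (d0 x) (sk i x iS xS) (sk j x jS xS).
by rewrite !mulrDr opprD e => ->.
Qed.

Lemma sex_mutate S x z : x \in sex S ->
  (z \in sex (mutate S x)) = (z == newvar S x) || (z != x) && (z \in sex S).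
Proof. by move=> xS; rewrite /mutate xS !fsE. Qed.

Lemma sfr_mutate S x : sfr (mutate S x) = sfr S.
Proof. by rewrite /mutate; case: ifP. Qed.

(** Renames the new variable back to [x], so that the mutated matrix is [mutb] read in the old
    variables. *)
Definition unmut S x z := if z == newvar S x then x else z.

Lemma sb_mutate S x u v : x \in sex S ->
  sb (mutate S x) u v =
  if (u \in ext (mutate S x)) && (v \in sex (mutate S x))
  then mutb S x (unmut S x u) (unmut S x v) else 0.
Proof. by rewrite /mutate => xS; rewrite xS. Qed.

Lemma unmut_sex S x z : x \in sex S -> z \in sex (mutate S x) -> unmut S x z \in sex S.
Proof. by move=> xS; rewrite sex_mutate // /unmut; case: ifP => //= _ /andP[]. Qed.

Lemma wf_mutate S x : wf S -> x \in sex S -> wf (mutate S x).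
Proof.
move=> wfS xS; have fr := newvar_fresh wfS xS; split.
- move=> z; rewrite sex_mutate // sfr_mutate => /orP[/eqP->|/andP[_]]; last exact: wf_disj.
  by apply: contraNN fr; rewrite fsE orbC => ->.
- by move=> u v h; rewrite sb_mutate // (negPf h).
- have [d d0 sk] := wf_skew wfS; exists (d \o unmut S x) => [u|u v uS vS]; first exact: d0.
  rewrite !sb_mutate // !(sex_ext uS) !(sex_ext vS) uS vS /=.
  by apply: mutb_skew => //; apply: unmut_sex.
- move=> c c0; set x' := newvar S x.
  (* The exchange relation is solved for [x]: this value of [x] forces the value [c x'] on the new
     variable. *)
  pose t := exch S x c / c x'; pose c1 z := if z == x then t else c z.
  have t0 : 0 < t by rewrite divr_gt0 // exch_gt0.
  have [|a ha] := @wf_free _ wfS c1; first by move=> z; rewrite /c1; case: ifP.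
  exists a => y; rewrite mem_ext_mutate // => /orP[/eqP->|/andP[yx yS]]; last first.
    by have := ha y yS; rewrite /c1 (negPf yx).
  have -> : c x' = exch S x c1 / c1 x.
    (* [x] does not occur in its own exchange polynomial, because the diagonal entry is 0, so
       changing its value is harmless. *)
    rewrite {2}/c1 eqxx /t (@eq_exch _ S x c1 c); last first.
      by move=> z _; rewrite /c1; have [->|//] := eqVneq z x; rewrite sb_diag // eqxx.
    by rewrite invfM invrK mulrA divff ?mul1r // gt_eqF // exch_gt0.
  apply: evalsto_mul; first exact: evalsto_exch.
  by apply: evalsto_inv; [rewrite /c1 eqxx gt_eqF | apply/ha/sex_ext].
Qed.

Lemma seed_eq S T : sex S = sex T -> sfr S = sfr T ->
  (forall u v, sb S u v = sb T u v) -> S = T.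
Proof.
case: S T => [e f b] [e' f' b'] /= -> -> eb; congr Seed.
by apply: functional_extensionality => u; apply: functional_extensionality.
Qed.

(** * Mutation is an involution *)

Section Involution.
Variables (S : seed n k) (x : F).
Hypotheses (wfS : wf S) (xS : x \in sex S).
Let x' := newvar S x.
Let S' := mutate S x.

Let x'x : x' != x.
Proof. by apply: contraTneq (sex_ext xS) => <-; apply: newvar_fresh. Qed.

Lemma newvar_sex_mutate : x' \in sex S'.
Proof. by rewrite sex_mutate // eqxx. Qed.

Let ext_S' y : (y \in ext S') = (y == x') || (y != x) && (y \in ext S).
Proof. exact: mem_ext_mutate. Qed.

Let sb_x' y : y \in ext S -> sb S' y x' = - sb S y x.
Proof.
move=> yS; rewrite sb_mutate // newvar_sex_mutate /unmut eqxx andbT ext_S'.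
have yx' : y != x' by apply: contraTneq yS => ->; apply: newvar_fresh.
rewrite (negPf yx') yS andbT /=; case: eqP => [->|_] /=; first by rewrite sb_diag // oppr0.
by rewrite /mutb eqxx orbT.
Qed.

(** Column [x'] of the new matrix is minus column [x] of the old one, so the two monomials of the
    exchange polynomial trade places and their sum is unchanged. *)
Lemma newvar_mutate : newvar S' x' = x.
Proof.
have x0 : x != 0 by apply/(ext_neq0 wfS)/sex_ext.
suff e : exch S' x' id = exch S x id.
  by rewrite newvarE e /x' newvarE invfM invrK mulrA divff ?mul1r // exch_neq0.
have sb_S' y : y \in ext S' -> y != x' -> sb S' y x' = - sb S y x.
  by rewrite ext_S' => /orP[->//|/andP[_ /sb_x']].
have diag : sb S' x' x' = 0 by rewrite sb_diag //; apply: wf_mutate.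
(* A variable with a nonzero entry in either column is neither [x] nor [x'], hence lies in both
   extended clusters. *)
have mem z : (z \in ext S') && (sb S' z x' != 0) ->
    [/\ z \in ext S, z \in ext S' & sb S' z x' = - sb S z x].
  case/andP=> zS'; have [->|zx'] := eqVneq z x'; first by rewrite diag eqxx.
  have /andP[_ zS] : (z != x) && (z \in ext S) by move: zS'; rewrite ext_S' (negPf zx').
  by rewrite sb_S'.
have mem' z : (z \in ext S) && (sb S z x != 0) ->
    [/\ z \in ext S, z \in ext S' & sb S' z x' = - sb S z x].
  case/andP=> zS; have [->|zx] := eqVneq z x; first by rewrite sb_diag ?eqxx.
  by rewrite sb_x' // ext_S' zx zS orbT.
rewrite /exch addrC; congr (_ + _); apply: eq_prod_fset => z; try
  by (move=> zS b; have [|_ _ ->] := mem z; rewrite ?abszN // zS neq_lt b ?orbT).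
all: apply/andP/andP => -[zS b].
- by have [|-> _ e] := mem z; [rewrite zS neq_lt b|split=> //; rewrite -oppr_lt0 -e].
- by have [|_ -> ->] := mem' z; [rewrite zS neq_lt b orbT|rewrite oppr_lt0].
- by have [|-> _ e] := mem z; [rewrite zS neq_lt b orbT|split=> //; rewrite -oppr_gt0 -e].
- by have [|_ -> ->] := mem' z; [rewrite zS neq_lt b|rewrite oppr_gt0].
Qed.

Lemma mutateK : mutate S' x' = S.
Proof.
have wfS' : wf S' by apply: wf_mutate.
have x'S' := newvar_sex_mutate.
have fr := newvar_fresh wfS xS.
have ne z : z \in ext S -> (z == x') = false.
  by move=> zS; apply: contraNF fr => /eqP e; rewrite -/x' -e.
have sexE : sex (mutate S' x') = sex S.
  apply/fsetP => z; rewrite sex_mutate // newvar_mutate sex_mutate //.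
  have [->//|zx] := eqVneq z x; have [->|//] := eqVneq z x'.
  by symmetry; apply: contraNF fr => /sex_ext.
have extE : ext (mutate S' x') = ext S by rewrite /ext sexE !sfr_mutate.
apply: seed_eq => [//||u v]; first by rewrite !sfr_mutate.
rewrite sb_mutate // sexE extE.
case: ifP => [/andP[uS vS]|/negbT]; last by move/(wf_supp wfS).
have vS2 := sex_ext vS.
have old z : z \in ext S -> unmut S x z = z by move=> zS; rewrite /unmut ne.
have new : unmut S x x' = x by rewrite /unmut eqxx.
have sex' z : z \in sex S -> z != x -> z \in sex S'.
  by move=> zS zx; rewrite sex_mutate //; apply/orP; right; apply/andP.
have ext' z : z \in ext S -> z != x -> z \in ext S'.
  by move=> zS zx; rewrite ext_S'; apply/orP; right; apply/andP.
have sbx' z : z \in sex S -> z != x -> sb S' x' z = - sb S x z.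
  move=> zS zx; rewrite sb_mutate // (sex_ext x'S') (sex' z zS zx) new old ?sex_ext //.
  by rewrite /mutb eqxx.
have mutb_l T y j : mutb T y y j = - sb T y j by rewrite /mutb eqxx.
have unx' z : z != x -> unmut S' x' z = z.
  by rewrite /unmut newvar_mutate => /negPf->.
have unx : unmut S' x' x = x' by rewrite /unmut newvar_mutate eqxx.
have [->|ux] := eqVneq u x.
  rewrite unx mutb_l; have [->|vx] := eqVneq v x; first by rewrite unx !sb_diag ?oppr0.
  by rewrite unx' // sbx' // opprK.
rewrite unx' //; have [->|vx] := eqVneq v x.
  by rewrite unx /mutb eqxx orbT sb_x' // opprK.
(* Away from [x] both factors of the correction term change sign, so their product stays while the
   leading sign flips; the two corrections cancel. *)
rewrite unx' // {1}/mutb (ne u uS) (ne v vS2) /= sbx' // sb_x' // mulrNN sgzN.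
rewrite sb_mutate // (ext' u uS ux) (sex' v vS vx) !old // /mutb (negPf ux) (negPf vx) /=.
by rewrite mulNr addrK.
Qed.

End Involution.
End Exchange.

(** * Reachability between seeds *)

Section Reach.
Variables n k : nat.
Local Notation F := (Fld n k).
Implicit Types (S T U : seed n k) (x y z u v : F) (I : {fset F}).

Lemma adm_cat S xs ys : adm S (xs ++ ys) <-> adm S xs /\ adm (mutseq S xs) ys.
Proof.
elim: xs S => [|x xs IH] S /=; first by split=> // -[].
by rewrite IH and_assoc.
Qed.

Lemma mutseq_cat S xs ys : mutseq S (xs ++ ys) = mutseq (mutseq S xs) ys.
Proof. exact: foldl_cat. Qed.

Lemma reach_refl S : reach S S.
Proof. by exists [::]. Qed.

Lemma reach_step S x : x \in sex S -> reach S (mutate S x).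
Proof. by move=> xS; exists [:: x]. Qed.

Lemma reach_trans S T U : reach S T -> reach T U -> reach S U.
Proof.
move=> [xs [aS ->]] [ys [aT ->]]; exists (xs ++ ys).
by rewrite mutseq_cat adm_cat.
Qed.

Lemma reach_ind (P : seed n k -> Prop) S T : P S ->
  (forall U x, P U -> x \in sex U -> P (mutate U x)) -> reach S T -> P T.
Proof.
move=> PS step [xs [aS ->]]; elim: xs S PS aS => //= x xs IH S PS [xS].
by apply: IH; apply: step.
Qed.

Lemma wf_reach S T : wf S -> reach S T -> wf T.
Proof. by move=> wfS; apply: reach_ind => // U x; apply: wf_mutate. Qed.

(** Each step is undone by mutating at the new variable; well-formedness is carried along the
    induction so that [mutateK] applies. *)
Lemma reach_sym S T : wf S -> reach S T -> reach T S.
Proof.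
move=> wfS rST; suff [] : reach T S /\ wf T by [].
apply: (@reach_ind (fun U => reach U S /\ wf U)) rST => [|U x [rU wfU] xU].
  by split=> //; apply: reach_refl.
split; last exact: wf_mutate.
apply: reach_trans rU; rewrite -[X in reach _ X](mutateK wfU xU).
exact/reach_step/newvar_sex_mutate.
Qed.

End Reach.

(** * The initial seed satisfies the invariants *)

Section InitialSeed.
Variables (n k : nat) (B : 'M[int]_(n + k, n)).
Local Notation F := (Fld n k).

Lemma xv_inj : injective (@xv n k).
Proof.
move=> i j /eqP; rewrite tofrac_eq => /eqP.
move=> /(congr1 (meval (fun l => (l == i)%:R))); rewrite !mevalXU eqxx.
by case: eqP => // _ /eqP; rewrite oner_eq0.
Qed.

Lemma sb_seed0 i j : sb (seed0 B) (xv i) (xv (lshift k j)) = B i j.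
Proof.
rewrite /= (bigD1 i) //= (bigD1 j) //= !eqxx /= !big1 ?addr0 // => l lj.
- rewrite big1 // => r _; rewrite (_ : (xv i == xv l) = false) //.
  by apply: contraNF lj => /eqP/xv_inj ->.
- rewrite (_ : (xv (lshift k j) == xv (lshift k l)) = false) //.
  by apply: contraNF lj => /eqP/xv_inj/lshift_inj ->.
Qed.

Lemma mem_ext_seed0 z : z \in ext (seed0 B) <-> exists i, z = xv i.
Proof.
rewrite in_fsetU; split.
  by case/orP => /imfsetP[i _ ->]; eexists.
move=> [i ->]; rewrite -(splitK i); case: (split i) => j /=; apply/orP; [left|right];
  exact: in_imfset.
Qed.

Lemma wf_seed0 : skew_symmetrizable B -> wf (seed0 B).
Proof.
move=> [d [d0 sk]]; split.
- move=> x /imfsetP[i _ ->]; apply/negP => /imfsetP[j _ /xv_inj/eqP].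
  by rewrite eq_lrshift.
- move=> u v uv /=; apply: big1 => i _; apply: big1 => j _.
  case: ifP => // /andP[/eqP ui /eqP vj]; case/negP: uv; apply/andP; split.
    by apply/mem_ext_seed0; exists i.
  by rewrite vj; apply: in_imfset.
- have [dF dF0 dE] : exists2 dF : F -> int,
      (forall u, 0 < dF u) & (forall l, dF (xv (lshift k l)) = d l).
    (* Elements of the field that are not initial exchange variables get the default weight 1. *)
    exists (fun u => if [pick i | u == xv (lshift k i)] is Some i then d i else 1) => [u|l].
      by case: pickP.
    by case: pickP => [r /eqP/xv_inj/lshift_inj ->|/(_ l) /eqP].
  exists dF => // u v /imfsetP[i _ ->] /imfsetP[j _ ->].
  by rewrite !sb_seed0 !dE sk.
(* The prescribed values of the initial variables are the coordinates of the evaluation point. *)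
- move=> c c0; exists (c \o @xv n k) => y /mem_ext_seed0[i ->].
  by have := evalsto_poly (c \o @xv n k) 'X_i; rewrite mevalXU.
Qed.

End InitialSeed.

(** * Mixing-type sub-seeds and their mutations *)

Section Subseed.
Variables n k : nat.
Local Notation F := (Fld n k).
Implicit Types (S T U : seed n k) (x y z u v : F) (I : {fset F}).

(** The side conditions of [cluster_sub] on the pair of sets, elementwise; [cut_mutate] shows that
    they persist under mutation inside the sub-seed. *)
Record cut S (I0 I1 : {fset F}) : Prop := Cut {
  cut0 : {subset I0 <= sex S};
  cut1 : {subset I1 <= ext S};
  cut01 : forall z, z \in I0 -> z \notin I1;
  cut_sb : forall x y, x \in I1 -> y \in sex S `\` (I0 `|` I1) -> sb S x y = 0 }.

Lemma mem_sex_subseed S I0 I1 z :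
  (z \in sex (subseed S I0 I1)) = [&& z \notin I0, z \notin I1 & z \in sex S].
Proof. by rewrite in_fsetD in_fsetU negb_or andbA. Qed.

Lemma mem_sfr_subseed S I0 I1 z :
  (z \in sfr (subseed S I0 I1)) = (z \notin I1) && ((z \in sfr S) || (z \in I0)).
Proof. by rewrite in_fsetD in_fsetU. Qed.

Lemma mem_ext S z : (z \in ext S) = (z \in sex S) || (z \in sfr S).
Proof. exact: in_fsetU. Qed.

Lemma mem_ext_subseed S I0 I1 z : cut S I0 I1 ->
  (z \in ext (subseed S I0 I1)) = (z \notin I1) && (z \in ext S).
Proof.
move=> c; rewrite !mem_ext mem_sex_subseed mem_sfr_subseed.
case z1: (z \in I1) => /=; first by rewrite andbF.
case z0: (z \in I0); last by rewrite orbF.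
by rewrite (cut0 c) ?z0 ?orbT.
Qed.

Lemma sb_subseed S I0 I1 u v :
  u \in ext (subseed S I0 I1) -> v \in sex (subseed S I0 I1) ->
  sb (subseed S I0 I1) u v = sb S u v.
Proof. by move=> uS vS; rewrite /subseed /= -[_ `|` _]/(ext (subseed S I0 I1)) uS vS. Qed.

(** The rows dropped with [I1] have zero entries in the remaining columns, so no variable of the
    exchange polynomial is lost. *)
Lemma exch_subseed (R : comNzRingType) S I0 I1 x (c : F -> R) : cut S I0 I1 ->
  x \in sex (subseed S I0 I1) -> exch (subseed S I0 I1) x c = exch S x c.
Proof.
move=> cS xS; have zero z : z \in I1 -> sb S z x = 0 by move/(cut_sb cS); apply.
rewrite /exch; congr (_ + _); apply: eq_prod_fset => z; try
  by move=> zS _; rewrite sb_subseed.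
all: have := mem_ext_subseed z cS; have := @sb_subseed S I0 I1 z x.
all: case: (z \in ext (subseed S I0 I1)) => [->//|_].
all: try by move/esym/andP => -[_ ->].
all: move/esym/negbT; rewrite negb_and negbK => /orP[z1|/negPf->//].
all: by rewrite zero // ltxx andbF.
Qed.

Lemma newvar_subseed S I0 I1 x : cut S I0 I1 ->
  x \in sex (subseed S I0 I1) -> newvar (subseed S I0 I1) x = newvar S x.
Proof. by move=> cS xS; rewrite !newvarE exch_subseed. Qed.

Section MutateSubseed.
Variables (S : seed n k) (I0 I1 : {fset F}) (x : F).
Hypotheses (wfS : wf S) (cS : cut S I0 I1) (xs : x \in sex (subseed S I0 I1)).

Let x0 : x \notin I0. Proof. by move: xs; rewrite mem_sex_subseed => /and3P[]. Qed.
Let x1 : x \notin I1. Proof. by move: xs; rewrite mem_sex_subseed => /and3P[]. Qed.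

Lemma subseed_sex : x \in sex S.
Proof. by move: xs; rewrite mem_sex_subseed => /and3P[]. Qed.

Let xS := subseed_sex.

Let fresh0 : newvar S x \notin I0.
Proof. by apply: contraNN (newvar_fresh wfS xS) => /(cut0 cS)/sex_ext. Qed.

Let fresh1 : newvar S x \notin I1.
Proof. by apply: contraNN (newvar_fresh wfS xS) => /(cut1 cS). Qed.

Let sex_keep y : y \in sex S -> y != x -> y \in sex (mutate S x).
Proof. by move=> yS yx; rewrite sex_mutate //; apply/orP; right; apply/andP. Qed.

Let ext_keep y : y \in ext S -> y != x -> y \in ext (mutate S x).
Proof. by move=> yS yx; rewrite mem_ext_mutate //; apply/orP; right; apply/andP. Qed.

Let unmut_I1 y : y \in I1 -> unmut S x y = y.
Proof.
by move=> y1; rewrite /unmut; case: eqP => // e; move: fresh1; rewrite -e y1.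
Qed.

Lemma unmut_subseed y :
  y \in sex (subseed (mutate S x) I0 I1) -> unmut S x y \in sex (subseed S I0 I1).
Proof.
rewrite mem_sex_subseed => /and3P[y0 y1 yS]; rewrite mem_sex_subseed unmut_sex // andbT.
by rewrite /unmut; case: ifP => _; rewrite ?x0 ?x1 ?y0 ?y1.
Qed.

(** In a row from [I1] the entry in column [x] vanishes, hence so does the correction term, and the
    other zeros persist. *)
Lemma cut_mutate : cut (mutate S x) I0 I1.
Proof.
split; last 1 first.
- move=> u v u1 vS; have vs : v \in sex (subseed (mutate S x) I0 I1) by [].
  rewrite sb_mutate //; case: ifP => // _; rewrite unmut_I1 //.
  have zero y : y \in sex (subseed S I0 I1) -> sb S u y = 0 by apply: (cut_sb cS).
  rewrite /mutb (zero _ xs) zero ?unmut_subseed //.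
  by rewrite mul0r oppr0 addr0 if_same.
- move=> z z0; apply: sex_keep; first exact: (cut0 cS).
  by apply: contraNneq x0 => <-.
- move=> z z1; apply: ext_keep; first exact: (cut1 cS).
  by apply: contraNneq x1 => <-.
- exact: (cut01 cS).
Qed.

(** The sub-seed shares exchange relations and matrix entries with [S], and the new variable falls
    into neither [I0] nor [I1]. *)
Lemma mutate_subseed : mutate (subseed S I0 I1) x = subseed (mutate S x) I0 I1.
Proof.
have sexE : sex (mutate (subseed S I0 I1) x) = sex (subseed (mutate S x) I0 I1).
  apply/fsetP => z; rewrite sex_mutate // newvar_subseed // !mem_sex_subseed sex_mutate //.
  have [->|_] := eqVneq z (newvar S x); first by rewrite fresh0 fresh1.
  by rewrite /= !andbA; congr (_ && _); rewrite -!andbA andbC -andbA.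
have sfrE : sfr (mutate (subseed S I0 I1) x) = sfr (subseed (mutate S x) I0 I1).
  by apply/fsetP => z; rewrite sfr_mutate !mem_sfr_subseed sfr_mutate.
have extE : ext (mutate (subseed S I0 I1) x) = ext (subseed (mutate S x) I0 I1).
  by rewrite /ext sexE sfrE.
apply: seed_eq => // u v; rewrite sb_mutate // sexE extE.
case: ifP => [/andP[us vs]|/negbT h]; last first.
  rewrite /subseed /= -[_ `|` _]/(ext (subseed (mutate S x) I0 I1)).
  by rewrite -[_ `\` _]/(sex (subseed (mutate S x) I0 I1)) (negPf h).
have unE y : unmut (subseed S I0 I1) x y = unmut S x y by rewrite /unmut newvar_subseed.
rewrite sb_subseed // sb_mutate // !unE.
have uS : u \in ext (mutate S x) by move: us; rewrite (mem_ext_subseed _ cut_mutate) => /andP[].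
have vS : v \in sex (mutate S x) by move: vs; rewrite mem_sex_subseed => /and3P[].
rewrite uS vS /=.
have vs' := unmut_subseed vs.
have us' : unmut S x u \in ext (subseed S I0 I1).
  move: us; rewrite (mem_ext_subseed _ cut_mutate) => /andP[u1]; rewrite mem_ext_mutate //.
  rewrite /unmut; case: ifP => _; first by move=> _; apply: sex_ext.
  by case/andP => _ uS'; rewrite (mem_ext_subseed _ cS) u1.
by rewrite /mutb !sb_subseed // sex_ext.
Qed.

End MutateSubseed.

(** Mutations inside the sub-seed never touch [I0] or [I1], so the same pair cuts out every seed met
    on the way. *)
Lemma reach_subseed S I0 I1 U : wf S -> cut S I0 I1 -> reach (subseed S I0 I1) U ->
  exists T, [/\ reach S T, cut T I0 I1 & U = subseed T I0 I1].
Proof.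
move=> wfS cS.
apply: (@reach_ind _ _ (fun V => exists T, [/\ reach S T, cut T I0 I1 & V = subseed T I0 I1])).
  by exists S; split=> //; exact: reach_refl.
move=> _ x [T [rT cT ->]] xs; have wfT := wf_reach wfS rT.
exists (mutate T x); split.
- exact: reach_trans rT (reach_step (subseed_sex xs)).
- exact: cut_mutate.
- exact: mutate_subseed.
Qed.

End Subseed.

(** * Maps that commute with mutation *)

Section Compatible.
Variables n k : nat.
Local Notation F := (Fld n k).
Implicit Types (S T U : seed n k) (x y z u v : F) (f g : F -> F).

Lemma commmut_compat g S T : commmut g S T -> compat g S T.
Proof. by move=> /(_ [::] I). Qed.

Lemma commmut_step g S T x : commmut g S T -> x \in sex S ->
  g x \in sex T /\ commmut g (mutate S x) (mutate T (g x)).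
Proof.
move=> c xS; have [_ _ _ exE _] := commmut_compat c; split.
  by rewrite -exE ?sex_ext.
by move=> xs ax; apply: (c (x :: xs)).
Qed.

Lemma adm_map g S T xs : commmut g S T -> adm S xs -> adm T (map g xs).
Proof.
elim: xs S T => //= x xs IH S T c [xS ax]; have [gx c'] := commmut_step c xS.
by split=> //; apply: IH c' ax.
Qed.

Lemma commmut_reach g S T S' : commmut g S T -> reach S S' ->
  exists2 T', reach T T' & commmut g S' T'.
Proof.
move=> c [xs [ax ->]]; exists (mutseq T (map g xs)).
  by exists (map g xs); split=> //; apply: adm_map c ax.
move=> ys ay; rewrite -!mutseq_cat -map_cat; apply: c; exact/adm_cat.
Qed.

(** The letters are lifted one at a time, each along the surjection of extended clusters at the
    current seed. *)
Lemma commmut_lift g S T ys : commmut g S T -> adm T ys ->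
  exists2 xs, adm S xs & map g xs = ys.
Proof.
elim: ys S T => [|y ys IH] S T c /= => [_|[yT ay]]; first by exists [::].
have [_ surj _ exE _] := commmut_compat c.
have [x xS xy] := surj y (sex_ext yT).
have xS' : x \in sex S by rewrite exE // xy.
have [_ c'] := commmut_step c xS'; rewrite xy in c'.
by have [xs axs <-] := IH _ _ c' ay; exists (x :: xs); rewrite /= ?xy.
Qed.

Lemma commmut_reach_target g S T T' : commmut g S T -> reach T T' ->
  exists2 S', reach S S' & commmut g S' T'.
Proof.
move=> c [ys [/(commmut_lift c)[xs ax <-] ->]].
exists (mutseq S xs); first by exists xs.
move=> zs az; rewrite -!mutseq_cat -map_cat; apply: c; exact/adm_cat.
Qed.

Lemma commmut_comp f g S T U :
  commmut g S T -> commmut f T U -> commmut (f \o g) S U.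
Proof.
move=> cg cf xs ax.
have [g1 g2 g3 g4 g5] := cg xs ax.
have [f1 f2 f3 f4 f5] := cf _ (adm_map cg ax).
rewrite map_comp; split=> /=.
- by move=> y yS; apply/f1/g1.
- by move=> y /f2[z /g2[w wS <-] <-]; exists w.
- by move=> y z yS zS /f3 e; apply: g3 => //; apply: e; apply: g1.
- by move=> y yS; rewrite g4 // f4 // g1.
- by move=> x xS; rewrite g5 // f5 // -g4 // sex_ext.
Qed.

(** Every admissible sequence at [T] is the image of one at [S], where the compatibility of [f] can
    be inverted. *)
Lemma commmut_inv f g S T : cancel f g -> commmut f S T -> commmut g T S.
Proof.
move=> fK c ys /(commmut_lift c)[xs ax <-]; rewrite -map_comp.
rewrite (eq_map (fK : g \o f =1 id)) map_id.
have [f1 f2 f3 f4 f5] := c xs ax; split.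
- by move=> y /f2[x xS <-]; rewrite fK.
- by move=> x xS; exists (f x); rewrite ?f1.
- by move=> _ _ /f2[x xS <-] /f2[y yS <-]; rewrite !fK => ->.
- by move=> _ /f2[x xS <-]; rewrite fK f4.
- move=> y yT; have [x xS xy] := f2 y (sex_ext yT).
  by rewrite -xy fK -f5 ?fK // f4 // xy.
Qed.

Lemma clvar_commmut g S T z : commmut g S T -> clvar S z -> clvar T (g z).
Proof.
move=> c [S' [/(commmut_reach c)[T' rT /commmut_compat[g1 _ _ _ _]] zS]].
by exists T'; split=> //; apply: g1.
Qed.

Lemma clvar_commmut_target g S T w : commmut g S T -> clvar T w ->
  exists2 z, clvar S z & g z = w.
Proof.
move=> c [T' [/(commmut_reach_target c)[S' rS /commmut_compat[_ g2 _ _ _]] wT]].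
by have [z zS zw] := g2 w wT; exists z => //; exists S'.
Qed.

Lemma newvar_clvar S x : wf S -> x \in sex S -> clvar S (newvar S x).
Proof.
move=> wfS xS; exists (mutate S x); split; first exact: reach_step.
exact/sex_ext/newvar_sex_mutate.
Qed.

Lemma clvar_reach S T z : reach S T -> clvar T z -> clvar S z.
Proof. by move=> rS [U [rU zU]]; exists U; split=> //; apply: reach_trans rU. Qed.

Lemma clvar_ext S z : z \in ext S -> clvar S z.
Proof. by exists S; split=> //; apply: reach_refl. Qed.

Lemma clvar_subseed S I0 I1 z : wf S -> cut S I0 I1 ->
  clvar (subseed S I0 I1) z -> clvar S z.
Proof.
move=> wfS cS [U [/(reach_subseed wfS cS)[T [rT cT ->]]]].
by rewrite (mem_ext_subseed _ cT) => /andP[_ zT]; exists T.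
Qed.

Lemma prod_marked (A : {fset F}) (P : pred F) (e : F -> nat) x : x \in A ->
  \prod_(z <- A | P z) (if z == x then 2 else 1 : rat) ^+ e z =
  if P x then 2 ^+ e x else 1.
Proof.
move=> xA; rewrite big_mkcond (bigD1_seq x) ?fset_uniq //= eqxx.
rewrite big1 ?mulr1 // => z /negPf->; by rewrite expr1n if_same.
Qed.

(* Evaluating both exchange polynomials at the point where [g x] is 2 and every
   other variable is 1 detects whether [g x] occurs. *)
Lemma compat_sb0 g S T x y : wf T -> compat g S T ->
  g (newvar S y) * g y = exch S y g ->
  x \in ext S -> y \in sex S -> sb S x y = 0 -> sb T (g x) (g y) = 0.
Proof.
move=> wfT [g1 _ ginj exE gnew] gexch xS yS sxy.
have yT : g y \in sex T by rewrite -exE ?sex_ext.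
pose c (z : F) : rat := if z == g x then 2 else 1.
have [|a ha] := @wf_free _ _ _ wfT c; first by move=> z; rewrite /c; case: ifP.
have e1 : evalsto a (exch T (g y) id) (exch T (g y) c) by apply: evalsto_exch.
have e2 : evalsto a (exch S y g) (exch S y (c \o g)).
  by apply: evalsto_exch => z zS; apply/ha/g1.
(* [g] respects the new variable at [y], so the two exchange polynomials are the same field element
   and take the same value at [a]. *)
have eTS : exch T (g y) id = exch S y g.
  by rewrite -gexch gnew // newvarE divfK // (ext_neq0 wfT) ?sex_ext.
rewrite eTS in e1; have := evalsto_unique e1 e2.
(* Only [x] is sent to [g x], and [x] is absent from column [y], so every variable occurring on the
   side of [S] has value 1. *)
rewrite [RHS](@eq_exch _ _ _ _ _ _ (fun=> 1 : rat)) => [|z zS szy]; last first.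
  rewrite /c /=; case: eqP => // /ginj e.
  by move: szy; rewrite e // sxy eqxx.
rewrite exch1 /exch /c !prod_marked ?g1 //.
have [b0|b0|//] := ltgtP (sb T (g x) (g y)) 0; rewrite ?ltNge.
(* One monomial is 1 and the sum is 2, so the power of 2 is 1 and its exponent, the absolute value
   of the entry, is 0. *)
all: set m := (2 ^+ _ : rat) => e; have /eqP : m = 1 by move: e; lra.
all: by rewrite pexprn_eq1 // orbF absz_eq0 => /eqP.
Qed.

(** The conditions on [J0] and [J1] range over all cluster variables of [S], not just its extended
    cluster, so that they survive the mutations in the induction. *)
Lemma commmut_subseed g S T (I0 I1 J0 J1 : {fset F}) : wf S -> wf T ->
  commmut g S T -> cut S I0 I1 -> cut T J0 J1 ->
  (forall y, clvar S y -> (g y \in J0) = (y \in I0)) ->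
  (forall y, clvar S y -> (g y \in J1) = (y \in I1)) ->
  commmut g (subseed S I0 I1) (subseed T J0 J1).
Proof.
move=> wfS wfT c cS cT eJ0 eJ1 xs.
elim: xs S T wfS wfT c cS cT eJ0 eJ1 => [|x xs IH] S T wfS wfT c cS cT eJ0 eJ1.
  move=> _ /=; have [g1 g2 g3 g4 g5] := commmut_compat c; split.
  - move=> y; rewrite (mem_ext_subseed _ cS) (mem_ext_subseed _ cT) => /andP[y1 yS].
    by rewrite eJ1 ?y1 ?g1 //; apply: clvar_ext.
  - move=> w; rewrite (mem_ext_subseed _ cT) => /andP[w1 /g2[y yS yw]]; exists y => //.
    by rewrite (mem_ext_subseed _ cS) yS andbT -eJ1 ?yw //; apply: clvar_ext.
  - move=> y z; rewrite !(mem_ext_subseed _ cS) => /andP[_ yS] /andP[_ zS]; exact: g3.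
  - move=> y; rewrite (mem_ext_subseed _ cS) => /andP[_ yS].
    have yc := clvar_ext yS.
    by rewrite !mem_sex_subseed eJ0 // eJ1 // g4.
  - move=> x xs; have xS := subseed_sex xs.
    rewrite !newvar_subseed //; first exact: g5.
    have xc := clvar_ext (sex_ext xS).
    by move: xs; rewrite !mem_sex_subseed eJ0 // eJ1 // g4 // sex_ext.
move=> /= [xs' ax]; have xS := subseed_sex xs'.
have xc := clvar_ext (sex_ext xS).
have [gxT c'] := commmut_step c xS.
have gx' : g x \in sex (subseed T J0 J1).
  by move: xs'; rewrite !mem_sex_subseed eJ0 // eJ1 // gxT xS.
rewrite !mutate_subseed // in ax *.
have rS := reach_step xS.
apply: IH => //; try exact: wf_mutate; try exact: cut_mutate.
- by move=> y /(clvar_reach rS); apply: eJ0.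
- by move=> y /(clvar_reach rS); apply: eJ1.
Qed.

End Compatible.

(** * Cluster automorphisms as bijections of the ambient field *)

Section Automorphisms.
Variables (n k : nat) (B : 'M[int]_(n + k, n)).
Hypothesis hB : skew_symmetrizable B.
Local Notation F := (Fld n k).
Implicit Types (S T U : seed n k) (x y z u v : F) (f g : F -> F).

Let wf0 : wf (seed0 B) := wf_seed0 hB.

Lemma Acl1 S : Acl S 1.
Proof. by have := qgen_rat (clvar S) 1; rewrite /ratr divr1. Qed.

Lemma Acl_mono S T : (forall z, clvar S z -> Acl T z) -> forall z, Acl S z -> Acl T z.
Proof.
move=> ST z; elim=> {z} [z /ST//|q|z w _ IHz _ IHw|z w _ IHz _ IHw].
- exact: qgen_rat.
- exact: qgen_add.
- exact: qgen_mul.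
Qed.

Lemma aut_source f S : cluster_aut B f -> reach (seed0 B) S ->
  exists2 T, reach (seed0 B) T & commmut f S T.
Proof.
move=> [[_ [T1 [T2 [r1 r2 c]]]] _] rS.
have [T rT cT] := commmut_reach c (reach_trans (reach_sym wf0 r1) rS).
by exists T => //; apply: reach_trans rT.
Qed.

(** Outside the algebra [f] is the identity, so no outside element can be mapped inside. *)
Lemma aut_A0 f z : cluster_aut B f -> A0 B (f z) <-> A0 B z.
Proof.
move=> [[[f1 f2 f3 _ _] _] fout]; split=> [Afz|]; last exact: f1.
by apply: NNPP => nAz; apply: (nAz); rewrite -(fout z nAz).
Qed.

Lemma aut_inj f : cluster_aut B f -> injective f.
Proof.
move=> af z w fzw; have [[[_ _ f3 _ _] _] fout] := af.
have [Az|nAz] := classic (A0 B z).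
  by apply: f3 => //; apply/(aut_A0 _ af); rewrite -fzw; apply/(aut_A0 _ af).
have nAw : ~ A0 B w by move=> /(aut_A0 _ af); rewrite -fzw => /(aut_A0 _ af).
by rewrite -(fout z) // -(fout w).
Qed.

Lemma aut_surj f w : cluster_aut B f -> exists z, f z = w.
Proof.
move=> [[[_ f2 _ _ _] _] fout]; have [/f2[z [_ e]]|/fout e] := classic (A0 B w).
  by exists z.
by exists w.
Qed.

Lemma aut_comp f g : cluster_aut B f -> cluster_aut B g -> cluster_aut B (f \o g).
Proof.
move=> af ag; split; last first.
  move=> z nz /=; have [_ gout] := ag; have [_ fout] := af.
  by rewrite gout ?fout.
have Ag z : A0 B z -> A0 B (g z) by move/(aut_A0 _ ag).
split; last first.
  have [[_ [T1 [T2 [r1 r2 c]]]] _] := ag.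
  (* The target seed of [g] need not be the source seed supplied with [f], so [f] is restarted from
     it. *)
  have [U rU cU] := aut_source af r2.
  by exists T1, U; split=> //; apply: commmut_comp c cU.
have [[[f1 f2 f3 f4 [f5 f6 f7]] _] _] := af.
have [[[g1 g2 g3 g4 [g5 g6 g7]] _] _] := ag.
split=> /=.
- by move=> z /g1/f1.
- by move=> w /f2[z [/g2[y [Ay <-]] <-]]; exists y.
- by move=> z w Az Aw /(aut_inj af)/(aut_inj ag).
- by rewrite g4.
- split=> [z w Az Aw|z w Az Aw|q z Az].
  + by rewrite g5 // f5 //; apply: Ag.
  + by rewrite g6 // f6 //; apply: Ag.
  + by rewrite g7 // f7 //; apply: Ag.
Qed.

Lemma aut_inv f : cluster_aut B f ->
  exists g, [/\ cluster_aut B g, cancel f g & cancel g f].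
Proof.
move=> af; have finj := aut_inj af.
(* The inverse is built on the whole field by choosing preimages; it fixes the elements outside the
   algebra because [f] does. *)
pose g w := proj1_sig (constructive_indefinite_description _ (aut_surj w af)).
have gK : cancel g f by move=> w; rewrite /g; case: constructive_indefinite_description.
have fK : cancel f g by move=> z; apply: finj; rewrite gK.
have Ag w : A0 B (g w) <-> A0 B w by rewrite -(aut_A0 (g w) af) gK.
exists g; split=> //; have [[[f1 f2 f3 f4 [f5 f6 f7]] [T1 [T2 [r1 r2 c]]]] fout] := af.
split; last by move=> z nz; apply: finj; rewrite gK fout.
split; last by exists T2, T1; split=> //; apply: commmut_inv c.
split.
- by move=> w /Ag.
- by move=> z Az; exists (f z); split; [exact: f1 | rewrite fK].
- by move=> z w _ _ /(can_inj gK).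
- by rewrite -f4 fK.
- split=> [z w Az Aw|z w Az Aw|q z Az]; apply: finj; rewrite gK.
  + by rewrite f5 ?gK //; apply/Ag.
  + by rewrite f6 ?gK //; apply/Ag.
  + by rewrite f7 ?gK //; apply/Ag.
Qed.

(** * Transport of cluster subalgebras by an automorphism *)

Section Transport.
Variables (g : F -> F) (ag : cluster_aut B g).

Let gM z w : A0 B z -> A0 B w -> g (z * w) = g z * g w.
Proof. by have [[[_ _ _ _ [_ gm _]] _] _] := ag; apply: gm. Qed.

Let gD z w : A0 B z -> A0 B w -> g (z + w) = g z + g w.
Proof. by have [[[_ _ _ _ [gd _ _]] _] _] := ag; apply: gd. Qed.

Let g1 : g 1 = 1.
Proof. by have [[[]]] := ag. Qed.

Let gq q : g (ratr q) = ratr q.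
Proof.
have [[[_ _ _ _ [_ _ gz]] _] _] := ag.
by have := gz q 1 (Acl1 _); rewrite mulr1 g1 mulr1.
Qed.

(** Membership and image are proved together, since [g] is known to be multiplicative only on
    elements of the algebra. *)
Lemma aut_prod (s : seq F) (P : pred F) (e : F -> nat) :
  {in s, forall y, A0 B y} ->
  A0 B (\prod_(y <- s | P y) y ^+ e y) /\
  g (\prod_(y <- s | P y) y ^+ e y) = \prod_(y <- s | P y) g y ^+ e y.
Proof.
move=> As; rewrite 2!(big_seq_cond P).
apply: (big_rec2 (fun u v => A0 B u /\ g u = v)); first by split; [exact: Acl1|].
move=> y u v /andP[/As Ay _] [Av <-].
have [Aye gye] : A0 B (y ^+ e y) /\ g (y ^+ e y) = g y ^+ e y.
  elim: (e y) => [|m [Am gm]]; first by split; [exact: Acl1|].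
  by rewrite !exprS gM // gm; split=> //; apply: qgen_mul.
by rewrite gM // gye; split=> //; apply: qgen_mul.
Qed.

(** Supplies the exchange hypothesis of [compat_sb0]. The relation avoids division because [g] is a
    homomorphism on the algebra only, which need not contain the inverse of [x]. *)
Lemma aut_exch S x : reach (seed0 B) S -> x \in sex S ->
  g (newvar S x) * g x = exch S x g.
Proof.
move=> rS xS; have wfS := wf_reach wf0 rS.
have AS y : y \in ext S -> A0 B y by move=> yS; apply: qgen_var; exists S.
have An : A0 B (newvar S x) by apply/qgen_var/(clvar_reach rS)/newvar_clvar.
rewrite -gM //; last exact/AS/sex_ext.
rewrite newvarE divfK ?(ext_neq0 wfS) ?sex_ext //.
have [Ap gp] := aut_prod (fun y => 0 < sb S y x) (fun y => `|sb S y x|%N) AS.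
have [An' gn] := aut_prod (fun y => sb S y x < 0) (fun y => `|sb S y x|%N) AS.
by rewrite /exch gD // gp gn.
Qed.

Lemma Acl_aut S T z : commmut g S T -> (forall z, Acl S z -> A0 B z) ->
  Acl S z -> Acl T (g z).
Proof.
move=> c SA; elim=> {z} [z /(clvar_commmut c)|q|z w Az IHz Aw IHw|z w Az IHz Aw IHw].
- exact: qgen_var.
- by rewrite gq; apply: qgen_rat.
- by rewrite gD; [apply: qgen_add|apply: SA|apply: SA].
- by rewrite gM; [apply: qgen_mul|apply: SA|apply: SA].
Qed.

Lemma Acl_aut_target S T w : commmut g S T -> (forall z, Acl S z -> A0 B z) ->
  Acl T w -> exists2 z, Acl S z & g z = w.
Proof.
move=> c SA; elim=> {w} [w /(clvar_commmut_target c)[z Sz <-]|q|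
  _ _ _ [z Az <-] _ [w Aw <-]|_ _ _ [z Az <-] _ [w Aw <-]].
- by exists z => //; apply: qgen_var.
- by exists (ratr q); [apply: qgen_rat | rewrite gq].
- by exists (z + w); [apply: qgen_add | rewrite gD //; apply: SA].
- by exists (z * w); [apply: qgen_mul | rewrite gM //; apply: SA].
Qed.

(** A seed [T] matching [S] under [g] is cut along the images of [I0] and [I1]; [compat_sb0] gives
    the required zeros in the matrix of [T]. *)
Lemma aut_cluster_sub S1 : cluster_sub B S1 -> exists S2,
  [/\ cluster_sub B S2, (forall z, Acl S1 z -> Acl S2 (g z)),
      (forall w, Acl S2 w -> exists2 z, Acl S1 z & g z = w) & cluster_iso S1 S2 g].
Proof.
move=> [[S [I0 [I1 [rS [sI0 sI1] I01 sb0 ->]]]] SA].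
have wfS := wf_reach wf0 rS; have ginj := aut_inj ag.
have [T rT c] := aut_source ag rS; have wfT := wf_reach wf0 rT.
have cS : cut S I0 I1.
  split=> //; [exact/fsubsetP|exact/fsubsetP|].
  move=> z z0; apply/negP => z1.
  by have : z \in I0 `&` I1 by [rewrite in_fsetI z0]; rewrite I01.
pose J0 := [fset g y | y in I0]; pose J1 := [fset g y | y in I1].
have J0E y : (g y \in J0) = (y \in I0).
  by apply/imfsetP/idP => [[z z0 /ginj->]//|y0]; exists y.
have J1E y : (g y \in J1) = (y \in I1).
  by apply/imfsetP/idP => [[z z0 /ginj->]//|y0]; exists y.
have [c1 c2 c3 c4 c5] := commmut_compat c.
have cT : cut T J0 J1.
  split.
  - by move=> _ /imfsetP[y /= y0 ->]; rewrite -c4 ?(cut0 cS) // sex_ext ?(cut0 cS).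
  - by move=> _ /imfsetP[y /= y0 ->]; apply/c1/(cut1 cS).
  - by move=> _ /imfsetP[y /= y0 ->]; rewrite J1E (cut01 cS).
  - move=> _ v /imfsetP[x /= x1 ->]; rewrite -[v \in _]/(v \in sex (subseed T J0 J1)).
    rewrite mem_sex_subseed => /and3P[v0 v1 vT].
    have [y yS yv] := c2 v (sex_ext vT); rewrite -yv in v0 v1 vT *.
    rewrite -c4 // in vT; rewrite J0E in v0; rewrite J1E in v1.
    apply: (compat_sb0 wfT (commmut_compat c)) => //; first exact: aut_exch.
      exact: (cut1 cS).
    apply: sb0 => //; rewrite -[_ \in _]/(y \in sex (subseed S I0 I1)).
    by rewrite mem_sex_subseed v0 v1.
have c' : commmut g (subseed S I0 I1) (subseed T J0 J1) by apply: commmut_subseed.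
have TA : forall z, Acl (subseed T J0 J1) z -> A0 B z.
  by apply: Acl_mono => z /(clvar_subseed wfT cT)/(clvar_reach rT)/qgen_var.
have to z : Acl (subseed S I0 I1) z -> Acl (subseed T J0 J1) (g z) by apply: Acl_aut.
have from w : Acl (subseed T J0 J1) w -> exists2 z, Acl (subseed S I0 I1) z & g z = w.
  exact: Acl_aut_target.
exists (subseed T J0 J1); split=> //.
- split=> //; exists T, J0, J1; split=> //.
  + by split; apply/fsubsetP; [exact: (cut0 cT)|exact: (cut1 cT)].
  + apply/fsetP => z; rewrite in_fsetI in_fset0; apply/negP => /andP[/(cut01 cT)/negP].
    by [].
  + exact: (cut_sb cT).
- split; last first.
    by exists (subseed S I0 I1), (subseed T J0 J1); split=> //; apply: reach_refl.
  split=> //.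
  + by move=> w /from[z Az zw]; exists z.
  + by move=> z w _ _ /ginj.
  + split=> [z w Az Aw|z w Az Aw|q z Az].
    * by apply: gD; apply: SA.
    * by apply: gM; apply: SA.
    * by rewrite gM ?gq //; [exact: qgen_rat | exact: SA].
Qed.

End Transport.

Lemma aut_conj f g gi : cluster_aut B f -> cluster_aut B g -> cluster_aut B gi ->
  cluster_aut B (fun z => g (f (gi z))).
Proof. by move=> af ag agi; apply: (aut_comp ag (aut_comp af agi)). Qed.

End Automorphisms.

(** * Conjugate subgroups and isomorphic maximal subalgebras *)

Theorem theoremA (n k : nat) (B : 'M[int]_(n + k, n))
  (hB : skew_symmetrizable B)
  (H1 H2 : (Fld n k -> Fld n k) -> Prop)
  (hH1 : subgroup_aut B H1) (hH2 : subgroup_aut B H2)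
  (hM1 : exists S, inM B H1 S) (hM2 : exists S, inM B H2 S) :
  conjugate_aut B H1 H2 <->
  exists f S1 S2,
    [/\ cluster_aut B f, inM B H1 S1, inM B H2 S2,
        (forall z, Acl S1 z -> Acl S2 (f z)) /\
        (forall w, Acl S2 w -> exists2 z, Acl S1 z & f z = w) &
        cluster_iso S1 S2 f].
Proof.
split.
- move=> [g ag conj]; have [S1 M1] := hM1.
  have [gi [agi gK giK]] := aut_inv ag.
  have [sub1 fix1 max1 gal1] := M1.
  have [S2 [sub2 to from iso]] := aut_cluster_sub hB ag sub1.
  exists g, S1, S2; split=> //; split=> //.
  (* An element of [H2] is a conjugate by [g] of some [h] in [H1], and [h] fixes the preimage of
     [w]. *)
  + move=> w Aw; split; first by have [_] := sub2; apply.
    move=> f /conj[h Hh fg]; have [z Az <-] := from w Aw.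
    by rewrite fg; have [_ ->] := fix1 z Az.
  (* Maximality: a larger candidate is pulled back along [gi], compared with [S1] there, and the
     inclusion is pushed forward by [g]. *)
  + move=> S fixedsub fixed S2S.
    have [S3 [sub3 to3 from3 _]] := aut_cluster_sub hB agi fixedsub.
    have S31 : forall z, Acl S3 z -> Acl S1 z.
      apply: max1 => // [z /from3[w Aw <-]|z Az]; last first.
        by rewrite -(gK z); apply/to3/S2S/to.
      have [Aw' wfix] := fixed w Aw; split; first exact/(aut_A0 _ agi).
      move=> h Hh; apply: (can_inj gK); rewrite giK.
      (* The conjugate of [h] by [g] lies in [H2] and so fixes [w]; undoing [g] shows that [h] fixes
         [gi w]. *)
      have /wfix // : H2 (fun z => g (h (gi z))).
      by apply/conj; exists h => // y; rewrite gK.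
    by move=> z Az; rewrite -(giK z); apply/to/S31/to3.
  (* The automorphisms fixing [Acl S2] pointwise are the conjugates by [g] of those fixing
     [Acl S1]. *)
  + move=> f; split=> [[af ffix]|].
      apply/conj; exists (fun z => gi (f (g z))) => [|z]; last by rewrite giK.
      apply/gal1; split; first exact: (aut_conj hB af agi ag).
      by move=> z Az; rewrite ffix ?gK //; apply: to.
    move=> Hf; have [hf _ _ _] := hH2; split; first exact: hf.
    move=> w /from[z Az <-]; have [h Hh ->] := (conj f).1 Hf.
    by have [_ ->] := fix1 z Az.
(* Conversely, [gal1] and [gal2] recover both subgroups as Galois groups, and conjugation by [g]
   carries the first to the second. *)
- move=> [g [S1 [S2 [ag [_ _ _ gal1] [_ _ _ gal2] [to from] _]]]].
  have [gi [agi gK giK]] := aut_inv ag.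
  exists g => // f; split=> [/gal2[af ffix]|[h /gal1[ah hfix] fg]].
    exists (fun z => gi (f (g z))) => [|z]; last by rewrite giK.
    apply/gal1; split; first exact: (aut_conj hB af agi ag).
    by move=> z Az; rewrite ffix ?gK //; apply: to.
  (* [fg] determines [f] everywhere, since every [z] is [g (gi z)]. *)
  apply/gal2; have -> : f = fun z => g (h (gi z)).
    by apply: functional_extensionality => z; rewrite -fg giK.
  split; first exact: (aut_conj hB ah ag agi).
  by move=> w /from[z Az <-]; rewrite gK hfix.
Qed.
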